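(* Let $1\le k\le n$. Each of the sets $\{a_\pi^{(k)}:\pi\in S_n\}$, $\{b_\pi^{(k)}:\pi\in S_n\}$, $\{c_\pi^{(k)}:\pi\in S_n\}$ forms a basis of $\mathbf{H}'_{(1^{k-1},n-k+1)}$.
   Context: For $\pi\in S_n$ let $\mathrm{Des}(\pi)=\{1\le i\le n-1:\pi(i)>\pi(i+1)\}$. Define $d_i^{(k)}(\pi)=|\mathrm{Des}(\pi)\cap\{i,\dots,k-1\}|$ if $1\le i<k$, $d_k^{(k)}(\pi)=0$, and $d_i^{(k)}(\pi)=|\mathrm{Des}(\pi)\cap\{k,\dots,i-1\}|$ if $k<i\le n$. Define $\mathrm{inv}_i^{(k)}(\pi)=|\{j: i<j\le k,\ \pi(i)>\pi(j)\}|$ if $1\le i<k$, $\mathrm{inv}_k^{(k)}(\pi)=0$, and $\mathrm{inv}_i^{(k)}(\pi)=|\{j: k\le j<i,\ \pi(j)>\pi(i)\}|$ if $k<i\le n$. The $k$-th descent, Artin and Haglund monomials are $$a_\pi^{(k)}=\prod_{i=1}^{k-1}x_{\pi(i)}^{d_i^{(k)}(\pi)}\prod_{i=k+1}^{n}y_{\pi(i)}^{d_i^{(k)}(\pi)},\quad b_\pi^{(k)}=\prod_{i=1}^{k-1}x_{\pi(i)}^{\mathrm{inv}_i^{(k)}(\pi)}\prod_{i=k+1}^{n}y_{\pi(i)}^{\mathrm{inv}_i^{(k)}(\pi)},\quad c_\pi^{(k)}=\prod_{i=1}^{k-1}x_{\pi(i)}^{d_i^{(k)}(\pi)}\prod_{i=k+1}^{n}y_{\pi(i)}^{\mathrm{inv}_i^{(k)}(\pi)}.$$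 Let $\mathbf{Q}[\bar x,\bar y]=\mathbf{Q}[x_1,\dots,x_n,y_1,\dots,y_n]$. For the hook shape $\mu=(1^{k-1},n-k+1)$ let $\Delta_\mu$ be the determinant of the $n\times n$ matrix whose $i$-th row is $(1,y_i,\dots,y_i^{n-k},x_i,\dots,x_i^{k-1})$. Let $\mathbf{H}_\mu$ be the $\mathbf{Q}$-span of all partial derivatives (of all orders, including order $0$) of $\Delta_\mu$. Let $\langle f,g\rangle$ be the constant term of $f(\partial_{x_1},\dots,\partial_{x_n};\partial_{y_1},\dots,\partial_{y_n})\,g(\bar x;\bar y)$, let $J_\mu=\mathbf{H}_\mu^\perp$ with respect to $\langle\ ,\ \rangle$ in $\mathbf{Q}[\bar x,\bar y]$ (an ideal), and $\mathbf{H}'_\mu=\mathbf{Q}[\bar x,\bar y]/J_\mu$. A set of polynomials is said to form a basis of $\mathbf{H}'_\mu$ if its image does. *)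

(* Defs.v *)
From HB Require Import structures.
From mathcomp Require Import all_boot all_order all_fingroup all_algebra.
From mathcomp Require Import boolp ssrcomplements.
From mathcomp Require Export mpoly.

Set Implicit Arguments.
Unset Strict Implicit.
Unset Printing Implicit Defensive.

Import GRing.Theory.
Local Open Scope ring_scope.
Local Open Scope quotient_scope.

(* Stated for families because hook_quot below carries no vectType structure,
   so that basis_of does not apply. *)
Definition is_basis (K : pzRingType) (V : lmodType K) (I : finType)
    (b : I -> V) : Prop :=
  (forall c : I -> K, \sum_i c i *: b i = 0 -> forall i, c i = 0) /\
  (forall v : V, exists c : I -> K, v = \sum_i c i *: b i).

(* diffop f g is f(d/dX) g. *)
Definition diffop (N : nat) (f g : {mpoly rat[N]}) : {mpoly rat[N]} :=
  \sum_(m <- msupp f) f@_m *: g^`M[m].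

Definition pairing (N : nat) (f g : {mpoly rat[N]}) : rat := (diffop f g)@_0%MM.

Lemma pairing_linearl N (a : rat) (f1 f2 g : {mpoly rat[N]}) :
  pairing (a *: f1 + f2) g = a * pairing f1 g + pairing f2 g.
Proof.
rewrite /pairing /diffop.
have E (f : {mpoly rat[N]}) d : (msize f <= d)%N ->
    \sum_(m <- msupp f) f@_m *: g^`M[m]
    = \sum_(m : 'X_{1..N < d}) f@_m *: g^`M[m].
  move=> led; rewrite (big_mksub ('X_{1..N < d})) ?msupp_uniq //=; last first.
    by move=> m /msize_mdeg_lt /leq_trans; apply.
  by rewrite big_rmcond //= => m /memN_msupp_eq0 ->; rewrite scale0r.
set d := maxn (msize (a *: f1 + f2)) (maxn (msize f1) (msize f2)).
rewrite (E (a *: f1 + f2) d) ?leq_maxl // (E f1 d) ?(E f2 d); first last.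
- by rewrite /d !leq_max leqnn !orbT.
- by rewrite /d !leq_max leqnn !orbT.
rewrite -mcoeffZ -mcoeffD scaler_sumr -big_split /=; congr mcoeff.
by apply: eq_bigr => m _; rewrite mcoeffD mcoeffZ scalerDl scalerA.
Qed.

(* The element i : 'I_n stands for the 1-based index pos i. *)
Definition pos (n : nat) (i : 'I_n) : nat := i.+1.

Section Statistics.
Variables (n k : nat) (pi : 'S_n).

Definition Des : {set 'I_n} :=
  [set i : 'I_n | [exists j : 'I_n, (pos j == (pos i).+1) && (pi j < pi i)%N]].

Definition dstat (i : 'I_n) : nat :=
  if (pos i < k)%N then #|[set j in Des | (pos i <= pos j < k)%N]|
  else if (k < pos i)%N then #|[set j in Des | (k <= pos j < pos i)%N]|
  else 0%N.

Definition invstat (i : 'I_n) : nat :=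
  if (pos i < k)%N then
    #|[set j : 'I_n | (pos i < pos j <= k)%N && (pi j < pi i)%N]|
  else if (k < pos i)%N then
    #|[set j : 'I_n | (k <= pos j < pos i)%N && (pi i < pi j)%N]|
  else 0%N.

End Statistics.

Section Polynomials.
Variables n k : nat.

Definition xvar (i : 'I_n) : {mpoly rat[n + n]} := 'X_(lshift n i).
Definition yvar (i : 'I_n) : {mpoly rat[n + n]} := 'X_(rshift n i).

Definition hook_monomial (pi : 'S_n) (ex ey : 'I_n -> nat) :
    {mpoly rat[n + n]} :=
  (\prod_(i : 'I_n | (pos i < k)%N) xvar (pi i) ^+ ex i) *
  (\prod_(i : 'I_n | (k < pos i)%N) yvar (pi i) ^+ ey i).

Definition descent_monomial (pi : 'S_n) : {mpoly rat[n + n]} :=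
  hook_monomial pi (dstat k pi) (dstat k pi).
Definition artin_monomial (pi : 'S_n) : {mpoly rat[n + n]} :=
  hook_monomial pi (invstat k pi) (invstat k pi).
Definition haglund_monomial (pi : 'S_n) : {mpoly rat[n + n]} :=
  hook_monomial pi (dstat k pi) (invstat k pi).

(* For 1 <= k <= n, row i is (1, y_i, ..., y_i^(n-k), x_i, ..., x_i^(k-1)). *)
Definition hook_Delta : {mpoly rat[n + n]} :=
  \det (\matrix_(i < n, j < n)
          if (j <= n - k)%N then yvar i ^+ j else xvar i ^+ (j - (n - k))).

Definition hook_H (g : {mpoly rat[n + n]}) : Prop :=
  exists (s : seq 'X_{1..n + n}) (c : 'X_{1..n + n} -> rat),
    g = \sum_(m <- s) c m *: hook_Delta^`M[m].

Definition hook_J : {pred {mpoly rat[n + n]}} :=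
  fun f => `[< forall g, hook_H g -> pairing f g = 0 >].

Fact hook_J_submod : submod_closed hook_J.
Proof.
split=> [|a f1 f2 /asboolP J1 /asboolP J2]; apply/asboolP => g Hg.
  by rewrite /pairing /diffop msupp0 big_nil mcoeff0.
by rewrite pairing_linearl J1 ?J2 // mulr0 addr0.
Qed.

HB.instance Definition _ :=
  GRing.isSubmodClosed.Build rat {mpoly rat[n + n]} hook_J hook_J_submod.

Definition hook_quot : Type := @Quotient.quot {mpoly rat[n + n]} hook_J.

HB.instance Definition _ := GRing.Zmodule.on hook_quot.

Definition hook_proj (f : {mpoly rat[n + n]}) : hook_quot :=
  \pi_(@Quotient.quot {mpoly rat[n + n]} hook_J) f.

Lemma hook_proj_eq f g : (hook_proj f == hook_proj g) = (f - g \in hook_J).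
Proof. exact: esym (Quotient.idealrBE _ _ _). Qed.

Fact hook_projD : {morph hook_proj : f g / f + g}.
Proof. by move=> f g; rewrite /hook_proj raddfD. Qed.

Definition hook_repr (u : hook_quot) : {mpoly rat[n + n]} := generic_quotient.repr u.

Fact hook_reprK : cancel hook_repr hook_proj.
Proof. exact: (@generic_quotient.reprK _ (@Quotient.quot {mpoly rat[n + n]} hook_J)). Qed.

Definition hook_scale (a : rat) (u : hook_quot) : hook_quot :=
  hook_proj (a *: hook_repr u).

Fact hook_scale_proj a f : hook_scale a (hook_proj f) = hook_proj (a *: f).
Proof.
apply/eqP; rewrite hook_proj_eq -scalerBr; apply: rpredZ.
by rewrite -hook_proj_eq hook_reprK.
Qed.

Fact hook_scaleA a b u : hook_scale a (hook_scale b u) = hook_scale (a * b) u.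
Proof. by rewrite -[u]hook_reprK !hook_scale_proj scalerA. Qed.

Fact hook_scale1 : left_id 1 hook_scale.
Proof. by move=> u; rewrite -[u]hook_reprK hook_scale_proj scale1r. Qed.

Fact hook_scaleDr : right_distributive hook_scale +%R.
Proof.
move=> a u v; rewrite -[u]hook_reprK -[v]hook_reprK.
by rewrite -hook_projD !hook_scale_proj scalerDr hook_projD.
Qed.

Fact hook_scaleDl u : {morph hook_scale^~ u : a b / a + b}.
Proof.
move=> a b; rewrite -[u]hook_reprK.
by rewrite !hook_scale_proj scalerDl hook_projD.
Qed.

HB.instance Definition _ := GRing.Zmodule_isLmodule.Build rat hook_quot
  hook_scaleA hook_scale1 hook_scaleDr hook_scaleDl.

Lemma hook_proj_is_linear : linear hook_proj.
Proof. by move=> a f g; rewrite hook_projD -hook_scale_proj. Qed.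

HB.instance Definition _ := GRing.isLinear.Build rat {mpoly rat[n + n]}
  hook_quot _ hook_proj hook_proj_is_linear.

Definition forms_basis (b : 'S_n -> {mpoly rat[n + n]}) : Prop :=
  is_basis (fun pi : 'S_n => hook_proj (b pi)).

End Polynomials.

(* Main.v *)
Require Import Defs.
From mathcomp Require Import all_boot.
From mathcomp Require Import all_order all_fingroup all_algebra zify.

(** Write Delta for the hook determinant.  A polynomial f lies in J iff f pairs
    to zero with all derivatives of Delta.  All terms of Delta have the same
    exponents up to order, so this says that for every monomial m the sum of
    f_m' Delta_(m + m') over the monomials m' of f vanishes (hook_J_sum).

    Independence.  For each family a dual family of monomials is given such that
    the products of the monomial of p with the dual monomial of q are terms of
    Delta for p = q, and otherwise only if p precedes q in a certain total order;
    this triangular pairing proves independence modulo J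
    (independent_of_triangular).  The order first compares the facets, that is,
    the sets of letters before and after place k: they are ordered as in a
    shelling of the complex whose faces are the supports of the monomials not
    killed by Delta (facet_le, hook_key_tri).  Within a facet, the x-letters
    and the y-letters can be treated separately, and reversal together with
    complementation turns the latter into the former.  What remains is a
    statement on one alphabet (alphabet_system), which is proved once for
    descent exponents, with ascents as duals (des_tri), and once for inversion
    exponents, with the complement in a staircase as duals (inv_tri).  The
    three families of the theorem arise by combining these two.

    Spanning follows from independence (basis_of_independent).  Consider the
    orbit under permutation of the letters of a point whose coordinate pairs are
    n distinct points on the two axes, k - 1 of them with x nonzero and n - k
    with y nonzero.  Up to a nonzero factor, the alternating sum of a monomial
    over the orbit is the coefficient of this monomial in Delta, as long as the
    degree does not exceed that of Delta (Delta_alt_eval).  Hence the top form of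
    any polynomial that vanishes on the orbit lies in J (top_form_in_J).  The
    orbit has n! points: n! monomials independent modulo J restrict to a basis
    of the functions on it, and taking top forms of the relation of another
    monomial with them expresses that monomial modulo J. *)

Set Implicit Arguments.
Unset Strict Implicit.
Unset Printing Implicit Defensive.

Import Order.TTheory GRing.Theory Num.Theory.

Notation lexseq := (seqlexi nat).

(** * Sums of distinct naturals and lexicographic comparison *)

Section DistinctNaturals.
Variables (T : finType) (f : T -> nat).
Implicit Types S : {set T}.

Lemma card_le_bound S m :
  {in S &, injective f} -> {in S, forall a, f a < m} -> #|S| <= m.
Proof.
move=> injf ltf; rewrite cardE -(size_map f) -(size_iota 0 m).
apply: uniq_leq_size; first by rewrite map_inj_in_uniq ?enum_uniq // => a b;
  rewrite !mem_enum; apply: injf.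
by move=> _ /mapP [a + ->]; rewrite mem_enum mem_iota => /ltf.
Qed.

(** The extremal case is that of the values 0, 1, ..., #|S|-1; removing a point
    of maximal value, which is at least #|S|-1, gives the induction. *)
Lemma sum_distinct_ge S :
  {in S &, injective f} -> 'C(#|S|, 2) <= \sum_(a in S) f a.
Proof.
have [s] := ubnP #|S|; elim: s S => // s IHs S; rewrite ltnS => leSs injf.
have [->|[a0 Sa0]] := set_0Vmem S; first by rewrite cards0.
case: (@arg_maxnP _ a0 (fun a => a \in S) f Sa0) => a Sa maxa.
rewrite (big_setD1 a) //=.
have cS : #|S| = #|S :\ a|.+1 by rewrite (cardsD1 a S) Sa.
rewrite cS binS bin1 addnC leq_add //.
  rewrite -ltnS -cS; apply: (card_le_bound injf) => b Sb.
  by rewrite ltnS; apply: maxa.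
apply: IHs; first by rewrite -cS.
by move=> b c /setD1P [_ Sb] /setD1P [_ Sc]; apply: injf.
Qed.

Lemma sum_distinct_eq S :
  {in S &, injective f} -> \sum_(a in S) f a <= 'C(#|S|, 2) ->
  {in S, forall a, f a < #|S|}.
Proof.
move=> injf sumle a0 Sa0.
case: (@arg_maxnP _ a0 (fun a => a \in S) f Sa0) => a Sa maxa.
apply: leq_ltn_trans (maxa _ Sa0) _.
have injD : {in S :\ a &, injective f}.
  by move=> b c /setD1P [_ Sb] /setD1P [_ Sc]; apply: injf.
have := sum_distinct_ge injD; move: sumle.
rewrite (big_setD1 a) //= (cardsD1 a S) Sa add1n binS bin1; lia.
Qed.

End DistinctNaturals.

Section Lexicographic.
Local Open Scope order_scope.

(** The form in which every lexicographic comparison below is proved: only the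
    first place where the two words differ matters, so all earlier letters may
    be assumed equal. *)
Lemma lexi_mkseq (N : nat) (f g : nat -> nat) :
  (forall i, (i < N)%N -> (forall j, (j < i)%N -> f j = g j) ->
     (f i <= g i)%N) ->
  (mkseq f N : lexseq) <= mkseq g N.
Proof.
move=> H; rewrite /mkseq.
suff IHm m : (forall i, (i < m + N)%N -> (forall j, (j < i)%N -> f j = g j) ->
      (f i <= g i)%N) -> (forall j, (j < m)%N -> f j = g j) ->
    (map f (iota m N) : lexseq) <= map g (iota m N).
  by apply: IHm.
elim: N m {H} => [|N IH] m H eqfg //=.
rewrite lexi_cons; apply/andP; split.
  by rewrite -[_ <= _]/(f m <= g m)%N; apply: H => //; lia.
apply/implyP; rewrite -[_ <= _]/(g m <= f m)%N => gef; apply: IH.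
  by move=> i ltiN; apply: H; lia.
move=> j; rewrite ltnS leq_eqVlt => /predU1P [->|]; last exact: eqfg.
by apply/eqP; rewrite eqn_leq gef andbT; apply: H => //; lia.
Qed.

Lemma lexi_cat (s1 s2 t1 t2 : lexseq) :
  size s1 = size t1 -> s1 <= t1 -> (s1 = t1 -> s2 <= t2) ->
  (s1 ++ s2 : lexseq) <= t1 ++ t2.
Proof.
elim: s1 t1 => [|x s1 IH] [|y t1] //=; first by move=> _ _; apply.
move=> [eqsz]; rewrite !lexi_cons => /andP [lexy /implyP le12] H /=.
rewrite lexy; apply/implyP => leyx; apply: IH => // [|eq1]; first exact: le12.
apply: H; rewrite eq1; congr cons.
by apply/eqP; rewrite eq_le lexy leyx.
Qed.

End Lexicographic.

(** * Facets and the reduction to one alphabet *)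

Section Places.
Variable n : nat.
Implicit Types (p q t : 'S_n.+1) (a b c : 'I_n.+1).

Lemma card_place_lt p m : m <= n.+1 -> #|[set a | p a < m]| = m.
Proof.
move=> lem; rewrite -(card_imset _ (@perm_inj _ p)).
have ->: p @: [set a | p a < m] = [set i : 'I_n.+1 | i < m].
  apply/setP=> i; apply/imsetP/idP => [[a + ->]|]; first by rewrite !inE.
  by rewrite inE => ltim; exists (p^-1%g i); rewrite ?inE permKV.
by rewrite -sum1dep_card (big_ord_narrow lem) big_const_ord iter_addn_0 mul1n.
Qed.

Lemma ex_place p r : r <= n -> exists c, p c = r :> nat.
Proof. by move=> ler; exists (p^-1%g (inord r)); rewrite permKV inordK. Qed.

(** Permutations p here send a letter to its 0-based place.  The value is 0, 1
    or 2 according as the letter stands before, at or after place r: for the hook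
    these are the letters that carry x-variables, none, and y-variables. *)
Definition facet r p a : nat := (r <= p a) + (r < p a).

Lemma facetE r p t a : facet r p a = facet r t a ->
  ((p a < r) = (t a < r)) * ((r < p a) = (r < t a)) *
  ((p a == r :> nat) = (t a == r :> nat)).
Proof. by rewrite /facet => E; do 2?split; lia. Qed.

(** Words in 0, 1, 2 with prescribed numbers of each letter form a shelling
    order: if t keeps the 0s of p to the right of c and the 2s of p to its left,
    then t is lexicographically at least p.  Before c a letter of p can only be
    raised; if the words agree up to there, a 0 of t that is not a 0 of p would
    make the 0s of t outnumber those of p. *)
Lemma facet_le r p t c : p c = r :> nat ->
  (forall a, p a < r -> c < a -> t a < r) ->
  (forall a, r < p a -> a < c -> r < t a) ->
  forall a, (forall b, b < a -> facet r p b = facet r t b) ->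
  facet r p a <= facet r t a.
Proof.
move=> pc Hlt Hgt a eqba.
(* Both words have r zeros, so the inclusion of zero sets is an equality. *)
have sub b : c <= a -> t b < r -> p b < r.
  move=> leca; suff /setP /(_ b): [set b | p b < r] = [set b | t b < r].
    by rewrite !inE => ->.
  apply/eqP; rewrite eqEcard !card_place_lt ?leqnn ?andbT;
    try by rewrite -pc; apply: ltnW.
  apply/subsetP=> {}b; rewrite !inE => ltp.
  case: (ltngtP b c) => [ltbc|ltcb|/val_inj eqbc].
  - by rewrite -(facetE (eqba b _)) // (leq_trans ltbc).
  - exact: Hlt.
  - by move: ltp; rewrite eqbc pc ltnn.
case: (ltngtP a c) => [ltac|ltca|/val_inj eqac]; last first.
- have := sub a; rewrite /facet eqac pc leqnn; lia.
- have := facetE (eqba c ltca); rewrite pc ltnn eqxx => -[_ /esym /eqP tc].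
  have ne : t a <> r :> nat.
    by rewrite -tc => /val_inj /perm_inj eqac; rewrite eqac ltnn in ltca.
  have ne' : p a <> r :> nat.
    by rewrite -pc => /val_inj /perm_inj eqac; rewrite eqac ltnn in ltca.
  have := sub a (ltnW ltca); rewrite /facet; lia.
- have ne : p a <> r :> nat.
    by rewrite -pc => /val_inj /perm_inj eqac; rewrite eqac ltnn in ltac.
  have := Hgt a; rewrite /facet; lia.
Qed.

(** Reversing both places and letters preserves descents and inversions and
    exchanges the two sides of place r, so that the y-variables need no separate
    treatment: they are the x-variables of this permutation, with n - r for r. *)
Definition revcomp p : 'S_n.+1 :=
  perm (inj_comp (inj_comp rev_ord_inj (@perm_inj _ p)) rev_ord_inj).

Lemma revcompE p a : revcomp p (rev_ord a) = n - p a :> nat.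
Proof. by rewrite permE /= rev_ordK subSS. Qed.

Lemma facet_revcomp r p a : r <= n ->
  facet (n - r) (revcomp p) (rev_ord a) = 2 - facet r p a.
Proof. by rewrite /facet revcompE; have := ltn_ord (p a); lia. Qed.

Definition position_rev p : 'S_n.+1 := perm (inj_comp rev_ord_inj (@perm_inj _ p)).

(** The mirror image of the previous comparison: reversing the places turns
    the words in 0, 1, 2 upside down. *)
Lemma facet_ge r p t c : p c = r :> nat ->
  (forall a, p a < r -> a < c -> t a < r) ->
  (forall a, r < p a -> c < a -> r < t a) ->
  forall a, (forall b, b < a -> facet r p b = facet r t b) ->
  facet r t a <= facet r p a.
Proof.
move=> pc Hlt Hgt a eqba.
have E s b : position_rev s b = n - s b :> nat by rewrite permE /= subSS.
have ler : r <= n by rewrite -pc -ltnS.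
have F s b : facet (n - r) (position_rev s) b = 2 - facet r s b.
  by rewrite /facet E; have := ltn_ord (s b); lia.
have: facet (n - r) (position_rev p) a <= facet (n - r) (position_rev t) a.
  apply: (@facet_le _ _ _ c); rewrite ?E ?pc // => b; rewrite ?E ?F.
  - by have := ltn_ord (p b); have := Hgt b; have := ltn_ord (t b); lia.
  - by have := ltn_ord (p b); have := Hlt b; have := ltn_ord (t b); lia.
  - by move=> /eqba ->.
rewrite !F /facet; lia.
Qed.

End Places.

(** What the x-half of a family of monomials has to satisfy for the independence
    argument.  Here e p a is the exponent of the letter a in the monomial of p,
    d p a is its exponent in a dual monomial, and r - t a is its exponent in the
    term of the determinant indexed by t.
    - The support conditions put the letters of A greater than c into the
      monomial, and those smaller than c into its dual, where c is the letter at
      place r and A the set of letters before it.  They make the comparison of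
      facets work.
    - sys_diag says that each monomial times its own dual is a term of the
      determinant.
    - sys_tri says that, within one facet, a monomial times the dual of another
      one can only be such a term if the keys are ordered. *)
Record alphabet_system n r (e d : 'S_n.+1 -> 'I_n.+1 -> nat)
    (key : 'S_n.+1 -> lexseq) : Prop := AlphabetSystem {
  sys_supp_e : forall (p : 'S_n.+1) c a,
    p c = r :> nat -> p a < r -> c < a -> 0 < e p a;
  sys_supp_d : forall (p : 'S_n.+1) c a,
    p c = r :> nat -> p a < r -> a < c -> 0 < d p a;
  sys_out : forall (p : 'S_n.+1) a, r <= p a -> e p a = 0 /\ d p a = 0;
  sys_diag : forall p, exists2 t : 'S_n.+1,
    facet r p =1 facet r t & forall a, e p a + d p a = r - t a;
  sys_tri : forall p q t : 'S_n.+1,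
    facet r p =1 facet r t -> facet r q =1 facet r t ->
    (forall a, e p a + d q a = r - t a) -> (key p <= key q)%O;
  sys_inj : forall p q, facet r p =1 facet r q -> key p = key q ->
    forall a, p a < r -> p a = q a;
  sys_size : forall p q, size (key p) = size (key q) }.

Section Combine.
Variables (n r : nat) (ler : r <= n).
Variables (e d : 'S_n.+1 -> 'I_n.+1 -> nat) (key : 'S_n.+1 -> lexseq).
Variables (e' d' : 'S_n.+1 -> 'I_n.+1 -> nat) (key' : 'S_n.+1 -> lexseq).
Hypothesis sysx : alphabet_system r e d key.
Hypothesis sysy : alphabet_system (n - r) e' d' key'.
Implicit Types (p q t : 'S_n.+1) (a b c : 'I_n.+1).

Let F p : lexseq := mkseq (fun i => facet r p (inord i)) n.+1.

(** Facets are compared first; the keys of the two alphabets only matter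
    between permutations with the same facet. *)
Definition hook_key p : lexseq := F p ++ (key p ++ key' (revcomp p)).

Let F_inj p q : F p = F q -> facet r p =1 facet r q.
Proof.
move=> eqF a; have := congr1 (fun s => nth 0 s a) eqF.
by rewrite !nth_mkseq // inord_val.
Qed.

Let F_le p q : (forall a, (forall b, b < a -> facet r p b = facet r q b) ->
  facet r p a <= facet r q a) -> (F p <= F q)%O.
Proof.
move=> H; apply: lexi_mkseq => i ltin eqF; apply: H => b ltb.
by rewrite -(inord_val b); apply: eqF; rewrite inordK in ltb.
Qed.

(** If the monomial of p times the dual monomial of q is the term of t, then the
    support conditions force the facet of t to lie between those of p and q; so
    when p and q have the same facet it is also the facet of t, and each alphabet
    can be treated on its own. *)
Lemma hook_key_tri p q t :
  (forall a, e p a + d q a = r - t a) ->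
  (forall a, e' (revcomp p) (rev_ord a) + d' (revcomp q) (rev_ord a)
             = t a - r) ->
  (hook_key p <= hook_key q)%O.
Proof.
move=> Hx Hy; have [cp pc] := ex_place p ler; have [cq qc] := ex_place q ler.
have lt_rev a b : a < b -> rev_ord b < rev_ord a.
  by rewrite /=; have := ltn_ord b; lia.
have le_pt : (F p <= F t)%O.
  apply: F_le; apply: (facet_le pc) => a lta ltac.
    by have := sys_supp_e sysx pc lta ltac; have := Hx a; lia.
  have := @sys_supp_e _ _ _ _ _ sysy (revcomp p) (rev_ord cp) (rev_ord a).
  rewrite !revcompE pc => /(_ erefl).
  have := Hy a; have := lt_rev _ _ ltac; have := ltn_ord (p a); lia.
have le_tq : (F t <= F q)%O.
  apply: F_le => a eqa; apply: (facet_ge qc) => [b ltb ltbc|b ltb ltbc|b].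
  - by have := sys_supp_d sysx qc ltb ltbc; have := Hx b; lia.
  - have := @sys_supp_d _ _ _ _ _ sysy (revcomp q) (rev_ord cq) (rev_ord b).
    rewrite !revcompE qc => /(_ erefl).
    have := Hy b; have := lt_rev _ _ ltbc; have := ltn_ord (q b); lia.
  - by move/eqa.
apply: lexi_cat => [||eqF]; first by rewrite !size_mkseq.
  exact: le_trans le_pt le_tq.
have eq_pt : F p = F t.
  by apply/eqP; rewrite eq_le le_pt eqF.
have fpt := F_inj eq_pt; have fqt := F_inj (etrans (esym eqF) eq_pt).
apply: lexi_cat => [||_]; first exact: sys_size sysx _ _.
  exact: sys_tri sysx _ _ _ fpt fqt Hx.
apply: (sys_tri sysy (t := revcomp t)) => a; rewrite -(rev_ordK a).
- by rewrite !facet_revcomp // fpt.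
- by rewrite !facet_revcomp // fqt.
- by rewrite Hy revcompE; have := ltn_ord (t (rev_ord a)); lia.
Qed.

Lemma hook_key_inj : injective hook_key.
Proof.
move=> p q /eqP; rewrite eqseq_cat ?size_mkseq // => /andP [/eqP eqF].
rewrite eqseq_cat; last exact: sys_size sysx _ _.
move=> /andP [/eqP eqx /eqP eqy]; have fpq := F_inj eqF.
apply/permP => a; case: (ltngtP (p a) r) => [lta|gta|eqa].
- exact: sys_inj sysx _ _ fpq eqx _ lta.
- have: revcomp p (rev_ord a) = revcomp q (rev_ord a).
    apply: (sys_inj sysy) => // [b|].
      by rewrite -(rev_ordK b) !facet_revcomp // fpq.
    by rewrite revcompE; have := ltn_ord (p a); lia.
  move/(congr1 val); rewrite /= !revcompE.
  have := ltn_ord (p a); have := ltn_ord (q a) => ? ? ?.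
  by apply/val_inj => /=; lia.
- apply/val_inj => /=; rewrite eqa.
  by have := (facetE (fpq a)).2; rewrite eqa eqxx => /esym /eqP.
Qed.

Lemma hook_key_diag p : exists t : 'S_n.+1,
  (forall a, e p a + d p a = r - t a) /\
  (forall a, e' (revcomp p) (rev_ord a) + d' (revcomp p) (rev_ord a)
             = t a - r).
Proof.
have [tx fx Hx] := sys_diag sysx p.
have [ty fy Hy] := sys_diag sysy (revcomp p).
(* The witnesses for the two alphabets have the facet of p, hence glue to one
permutation. *)
pose f a := if p a < r then tx a else rev_ord (ty (rev_ord a)).
have fyE a : facet r (revcomp ty) a = facet r p a.
  have := fy (rev_ord a); rewrite facet_revcomp // => E.
  have := @facet_revcomp _ (n - r) ty (rev_ord a) (leq_subr _ _).
  by rewrite rev_ordK subKn // -E /facet; lia.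
have revE a : rev_ord (ty (rev_ord a)) = revcomp ty a by rewrite permE.
have f_inj : injective f.
  move=> a b; rewrite /f !revE.
  have := fx a; have := fx b; have := fyE a; have := fyE b; rewrite /facet.
  case: ifP => Ha; case: ifP => Hb ? ? ? ?; try exact: perm_inj.
    by move=> /(congr1 val) /= ?; lia.
  by move=> /(congr1 val) /= ?; lia.
exists (perm f_inj); split => a; rewrite permE /f; case: ifP => Ha.
- exact: Hx.
- have [-> ->] := sys_out sysx (p := p) (a := a) ltac:(lia).
  by have := fyE a; rewrite revE /facet; lia.
- have [-> ->] := sys_out sysy (p := revcomp p) (a := rev_ord a)
    ltac:(rewrite revcompE; lia).
  by have := fx a; rewrite /facet; lia.
- rewrite Hy revE; have := revcompE ty (rev_ord a); rewrite rev_ordK => ->.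
  by have := ltn_ord (ty (rev_ord a)); lia.
Qed.

End Combine.

(** * Descent exponents *)

Lemma sum_le_eq (I : finType) (F G : I -> nat) :
  (forall i, F i <= G i) -> \sum_i G i <= \sum_i F i -> forall i, F i = G i.
Proof.
move=> leFG leGF i; apply/eqP; rewrite eqn_leq leFG /=.
move: leGF; rewrite (bigD1 i) //= [leqRHS](bigD1 i) //=.
have: \sum_(j | j != i) F j <= \sum_(j | j != i) G j by apply: leq_sum.
lia.
Qed.

Lemma sum1_ord_ge r i : \sum_(j < r | i <= j) 1 = r - i.
Proof.
elim: r => [|r IH]; first by rewrite big_ord0.
by rewrite big_mkcond big_ord_recr /= -big_mkcond IH; case: leqP; lia.
Qed.

Lemma step_down (W : nat -> nat) i l : i <= l -> W l < W i ->
  exists2 j, i <= j < l & W j.+1 < W j.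
Proof.
elim: l => [|l IH]; first by rewrite leqn0 => /eqP ->; rewrite ltnn.
rewrite leq_eqVlt => /predU1P [->|]; first by rewrite ltnn.
rewrite ltnS => leil lt; have [ltl|gel] := ltnP (W l.+1) (W l).
  by exists l; rewrite ?leil ?leqnn.
by have [j /andP [? ?] ?] := IH leil (leq_ltn_trans gel lt);
  exists j => //; lia.
Qed.

Lemma step_up (W : nat -> nat) i l : i <= l -> W i < W l ->
  exists2 j, i <= j < l & W j < W j.+1.
Proof.
elim: l => [|l IH]; first by rewrite leqn0 => /eqP ->; rewrite ltnn.
rewrite leq_eqVlt => /predU1P [->|]; first by rewrite ltnn.
rewrite ltnS => leil lt; have [ltl|gel] := ltnP (W l) (W l.+1).
  by exists l; rewrite ?leil ?leqnn.
by have [j /andP [? ?] ?] := IH leil (leq_trans lt gel);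
  exists j => //; lia.
Qed.

Section Letters.
Variables (n r : nat) (ler : r <= n).
Implicit Types (p q t : 'S_n.+1) (a b c : 'I_n.+1).

Definition letter p i : 'I_n.+1 := (p^-1)%g (inord i).

Lemma letterK p a : letter p (p a) = a.
Proof. by rewrite /letter inord_val permK. Qed.

Lemma place_letter p i : i <= n -> p (letter p i) = i :> nat.
Proof. by move=> lei; rewrite permKV inordK. Qed.

Lemma letter_place p a i : p a = i :> nat -> letter p i = a.
Proof. by move<-; apply: letterK. Qed.

(** Both prefixes have l + 1 letters. *)
Lemma prefix_sub_eq p t l : l < r -> (forall a, p a <= l -> t a <= l) ->
  forall a, t a <= l -> p a <= l.
Proof.
move=> ltl sub; suff /setP E: [set a | p a < l.+1] = [set a | t a < l.+1].
  by move=> a; have := E a; rewrite !inE !ltnS => ->.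
apply/eqP; rewrite eqEcard !card_place_lt ?leqnn ?andbT; try lia.
by apply/subsetP => a; rewrite !inE !ltnS; apply: sub.
Qed.

(** Suppose that the prefixes of p and t ending at each place of D contain the
    same letters.  If p and t first differ at place i, then the letter that t has
    there occurs later in p, with no place of D in between.  With D the descents
    of p this letter is larger than the one of p at i, with D the ascents it is
    smaller. *)
Lemma letter_first_diff (D : pred nat) p t i : i < r ->
  (forall a, (p a < r) = (t a < r)) ->
  (forall l, l < r -> D l -> forall a, p a <= l -> t a <= l) ->
  (forall j, j < i -> letter p j = letter t j) ->
  letter p i != letter t i ->
  exists2 j, i < j < r & letter p j = letter t i /\
    forall l, i <= l < j -> ~~ D l.
Proof.
move=> ltir ltr sub eqpt nei; pose b := letter t i.
have tb : t b = i :> nat by apply: place_letter; lia.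
have pbr : p b < r by rewrite ltr tb.
have ipb : i < p b.
  rewrite ltn_neqAle; apply/andP; split.
    by apply: contraNneq nei => E; apply/eqP; apply: letter_place.
  rewrite leqNgt; apply/negP => ltpb; have := eqpt _ ltpb.
  by rewrite letterK => /(congr1 t) /(congr1 val) /=; rewrite place_letter; lia.
exists (p b); rewrite ?ipb // letterK; split=> // l /andP [leil ltl].
apply/negP => Dl; have ltlr : l < r by lia.
by have := prefix_sub_eq ltlr (sub l ltlr Dl) (a := b); rewrite tb; lia.
Qed.

Definition des p i : bool := letter p i.+1 < letter p i.

Definition des_exp p a : nat := \sum_(j < r | p a <= j) des p j.
(** The dual exponents: ascents and descents between the place of a and r add
    up to the distance to r. *)
Definition asc_exp p a : nat := \sum_(j < r | p a <= j) ~~ des p j.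

Lemma des_asc_exp p a : des_exp p a + asc_exp p a = r - p a.
Proof.
rewrite -big_split -sum1_ord_ge /=; apply: eq_bigr => j _.
by case: des.
Qed.

(** The binomial coefficient is the least possible sum of distinct naturals over
    the prefix that ends at the descent j. *)
Definition des_weight p : nat := \sum_(j < r) des p j * 'C(j.+1, 2).

Definition des_key p : lexseq :=
  des_weight p :: mkseq (fun i => letter p i : nat) r.

(** A descent at j contributes 1 to the exponents of exactly the letters in the
    prefix of p that ends at j. *)
Lemma prefix_sum t p (w : nat -> nat) : (forall a, (p a < r) = (t a < r)) ->
  \sum_(a | t a < r) t a * \sum_(j < r | p a <= j) w j
  = \sum_(j < r) w j * \sum_(a | p a <= j) t a.
Proof.
move=> eqr; under eq_bigr do rewrite big_distrr /= big_mkcond /=.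
rewrite exchange_big /=; apply: eq_bigr => j _.
rewrite big_distrr /= -big_mkcondr /=; apply: eq_big => [a|a _].
  by rewrite -eqr; apply/idP/idP; have := ltn_ord j; lia.
by rewrite mulnC.
Qed.

Lemma prefix_sum_ge p t (j : 'I_r) : 'C(j.+1, 2) <= \sum_(a | p a <= j) t a.
Proof.
have := @sum_distinct_ge _ (fun a => t a : nat) [set a | p a < j.+1].
rewrite card_place_lt; last by have := ltn_ord j; lia.
by rewrite big_set /=; apply=> a b _ _ /val_inj /perm_inj.
Qed.

Lemma prefix_sum_eq p t (j : 'I_r) :
  \sum_(a | p a <= j) t a = 'C(j.+1, 2) -> forall a, p a <= j -> t a <= j.
Proof.
have := @sum_distinct_eq _ (fun a => t a : nat) [set a | p a < j.+1].
rewrite card_place_lt; last by have := ltn_ord j; lia.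
rewrite big_set /= => H E a lea; rewrite -ltnS.
apply: H; rewrite ?inE ?E //.
by move=> ? ? _ _ /val_inj /perm_inj.
Qed.

Lemma place_sum t j : j <= n -> \sum_(a | t a <= j) t a = 'C(j.+1, 2).
Proof.
move=> lej; rewrite (reindex_inj (@perm_inj _ t^-1)) /=.
under eq_bigl do rewrite permKV -ltnS.
under eq_bigr do rewrite permKV.
have lej' : j.+1 <= n.+1 by [].
by rewrite (big_ord_narrow lej') -bin2_sum big_mkord.
Qed.

(** Weigh the exponents by t.  On the right the total is the sum of all
    'C(j.+1, 2), j < r.  On the left each descent j of p and each ascent j of q
    contributes the sum of t over a prefix with j + 1 letters, which is at least
    'C(j.+1, 2).  Hence des_weight p <= des_weight q.  In case of equality each
    of these prefixes is also a prefix of t; so t permutes the increasing runs of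
    p, which makes it lexicographically larger than p, and it permutes the
    decreasing runs of q, which makes it smaller than q. *)
Lemma des_tri p q t :
  facet r p =1 facet r t -> facet r q =1 facet r t ->
  (forall a, des_exp p a + asc_exp q a = r - t a) ->
  (des_key p <= des_key q)%O.
Proof.
move=> fp fq Hx.
have ltp a : (p a < r) = (t a < r) by rewrite (facetE (fp a)).
have ltq a : (q a < r) = (t a < r) by rewrite (facetE (fq a)).
pose F (j : 'I_r) := des p j * 'C(j.+1, 2) + ~~ des q j * 'C(j.+1, 2).
pose G (j : 'I_r) := des p j * (\sum_(a | p a <= j) t a)
  + ~~ des q j * (\sum_(a | q a <= j) t a).
have leFG j : F j <= G j.
  by rewrite /F /G leq_add // leq_mul //; apply: prefix_sum_ge.
have sumG : \sum_j G j = \sum_(j < r) 'C(j.+1, 2).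
  rewrite big_split /= -(prefix_sum (des p)) //.
  rewrite -(prefix_sum (fun j => ~~ des q j)) // -big_split /=.
  under eq_bigr do rewrite -mulnDr Hx -sum1_ord_ge.
  rewrite (prefix_sum (fun=> 1)) //; apply: eq_bigr => j _.
  by rewrite mul1n place_sum //; have := ltn_ord j; lia.
have sumF : des_weight q + \sum_j F j = des_weight p + \sum_(j < r) 'C(j.+1, 2).
  rewrite /F big_split /= addnCA -big_split /=; congr (_ + _).
  by apply: eq_bigr => j _; case: des; rewrite ?mul1n ?mul0n ?addn0.
have leFGs : \sum_j F j <= \sum_j G j by apply: leq_sum => j _; apply: leFG.
rewrite lexi_cons; apply/andP; split.
  by rewrite -[(_ <= _)%O]/(des_weight p <= des_weight q)%N; lia.
apply/implyP; rewrite -[(_ <= _)%O]/(des_weight q <= des_weight p)%N => ge_w.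
have eqFG := sum_le_eq leFG ltac:(lia).
have subp l : l < r -> des p l -> forall a, p a <= l -> t a <= l.
  move=> ltl dl; apply: (@prefix_sum_eq p t (Ordinal ltl)) => /=.
  have := eqFG (Ordinal ltl); rewrite /F /G /= dl !mul1n.
  have := prefix_sum_ge p t (Ordinal ltl).
  have := prefix_sum_ge q t (Ordinal ltl).
  by rewrite /=; case: des => /=; lia.
have subq l : l < r -> ~~ des q l -> forall a, q a <= l -> t a <= l.
  move=> ltl dl; apply: (@prefix_sum_eq q t (Ordinal ltl)) => /=.
  have := eqFG (Ordinal ltl); rewrite /F /G /= dl !mul1n.
  have := prefix_sum_ge p t (Ordinal ltl).
  have := prefix_sum_ge q t (Ordinal ltl).
  by rewrite /=; case: des => /=; lia.
have le_pt i : i < r -> (forall j, j < i -> letter p j = letter t j) ->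
    letter p i <= letter t i.
  move=> lti eqpt; have [->//|ne] := eqVneq (letter p i) (letter t i).
  have [j /andP [ltij ltjr] [eqj noD]] := letter_first_diff lti ltp subp eqpt ne.
  rewrite leqNgt -eqj; apply/negP.
  move=> /(@step_down (fun l => letter p l) i j (ltnW ltij)) [l /noD].
  by rewrite /des => /negP.
have le_tq i : i < r -> (forall j, j < i -> letter q j = letter t j) ->
    letter t i <= letter q i.
  move=> lti eqqt; have [->//|ne] := eqVneq (letter q i) (letter t i).
  have [j /andP [ltij ltjr] [eqj noD]] :=
    letter_first_diff (D := fun l => ~~ des q l) lti ltq subq eqqt ne.
  rewrite leqNgt -eqj; apply/negP.
  move=> /(@step_up (fun l => letter q l) i j (ltnW ltij)) [l /noD].
  by rewrite negbK /des; lia.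
apply: lexi_mkseq => i lti eqpq.
have eqt j : j < i -> letter p j = letter t j /\ letter q j = letter t j.
  elim/ltn_ind: j => j IH ltj; have ltjr : j < r by lia.
  have := le_pt j ltjr (fun l ltl => proj1 (IH l ltl (ltn_trans ltl ltj))).
  have := le_tq j ltjr (fun l ltl => proj2 (IH l ltl (ltn_trans ltl ltj))).
  have := eqpq j ltj => E le1 le2.
  by split; apply: val_inj => /=; lia.
apply: (@leq_trans (letter t i)).
  by apply: le_pt => // j /eqt [].
by apply: le_tq => // j /eqt [].
Qed.

Lemma descent_system : alphabet_system r des_exp asc_exp des_key.
Proof.
have supp (D : pred nat) (p : 'S_n.+1) a j : p a <= j < r -> D j ->
    0 < \sum_(j < r | p a <= j) D j.
  move=> /andP [lej ltj] Dj; rewrite (bigD1 (Ordinal ltj)) //= Dj; lia.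
split.
- move=> p c a pc lta ltca.
  have := @step_down (fun l => letter p l) _ _ (ltnW lta).
  rewrite letterK -pc letterK => /(_ ltca) [j]; rewrite pc => H.
  exact: supp H.
- move=> p c a pc lta ltca.
  have := @step_up (fun l => letter p l) _ _ (ltnW lta).
  rewrite letterK -pc letterK => /(_ ltca) [j]; rewrite pc => H ltj.
  by apply: (supp (fun j => ~~ des p j)) H _; rewrite /des -leqNgt ltnW.
- move=> p a lea; have := des_asc_exp p a; lia.
- by move=> p; exists p => // a; apply: des_asc_exp.
- exact: des_tri.
- move=> p q _ [_ eqw] a lta; have := congr1 (nth 0 ^~ (p a)) eqw.
  rewrite !nth_mkseq // letterK => /val_inj {2}->.
  by apply: val_inj => /=; rewrite place_letter // -ltnS.
- by move=> p q; rewrite /= !size_mkseq.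
Qed.

End Letters.

(** * Inversion exponents *)

Section Artin.
Variables (n r : nat) (ler : r <= n).
Implicit Types (p q t : 'S_n.+1) (a b c : 'I_n.+1).

Definition inv_exp p a : nat :=
  if p a < r then #|[set b : 'I_n.+1 | (p a < p b <= r) && (b < a)]| else 0.

(** The rank of a, counted from 1, among the letters before place r.  A dual
    exponent measured from this staircase, rather than from the number of
    non-inversions, makes the pairing triangular. *)
Definition stair p a : nat := #|[set b : 'I_n.+1 | (p b < r) && (b < a)]|.+1.

Definition coinv_exp p a : nat :=
  if p a < r then stair p a - inv_exp p a else 0.

Definition inv_key p : lexseq :=
  mkseq (fun i => n - inv_exp p (inord i)) n.+1.

Lemma inv_exp_le p a : inv_exp p a <= n.
Proof.
rewrite /inv_exp; case: ifP => // _; apply: leq_trans (_ : a <= n); last first.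
  by rewrite -ltnS.
apply: (@card_le_bound _ (fun b => b : nat)) => [? ? _ _ /val_inj //|b].
by rewrite inE => /andP [].
Qed.

(** Among the smaller letters to the right of a, only the letter c at place r
    is not counted by the staircase; the slack when a < c gives the support
    condition on dual exponents. *)
Lemma inv_exp_stair p c a : p c = r :> nat ->
  inv_exp p a + (a < c) <= stair p a.
Proof.
move=> pc; rewrite /inv_exp /stair; case: ifP => _; last by case: ltnP.
set S := [set b : 'I_n.+1 | (p b < r) && (b < a)].
have: #|[set b : 'I_n.+1 | (p a < p b <= r) && (b < a)] :\ c| <= #|S|.
  apply/subset_leq_card/subsetP => b; rewrite !inE.
  case/and3P => nebc /andP [_ lebr] ->; rewrite andbT ltn_neqAle lebr andbT.
  by apply: contra nebc; rewrite -pc => /eqP /val_inj /perm_inj ->.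
rewrite [X in X + _](cardsD1 c) inE pc leqnn andbT; lia.
Qed.

Lemma stair_lt p a b : p a < r -> a < b -> stair p a < stair p b.
Proof.
move=> lta ltab; rewrite ltnS; apply: proper_card; apply/properP; split.
  by apply/subsetP => c; rewrite !inE => /andP [-> /=] /ltn_trans; apply.
by exists a; rewrite !inE ?lta ?ltab ?ltnn.
Qed.

Lemma stair_le p a : p a < r -> stair p a <= r.
Proof.
move=> lta; rewrite -[leqRHS](@card_place_lt _ p); last exact: leqW.
apply: proper_card; apply/properP; split.
  by apply/subsetP => c; rewrite !inE => /andP [].
by exists a; rewrite !inE ?lta ?ltnn.
Qed.

Lemma stair_card p a : p a < r ->
  #|[set b : 'I_n.+1 | (p b < r) && (b <= a)]| = stair p a.
Proof.
move=> lta; rewrite (cardsD1 a) inE lta leqnn add1n; congr _.+1.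
by apply: eq_card => b; rewrite !inE -val_eqE (ltn_neqAle b) andbCA.
Qed.

Lemma inv_coinv_exp p a : p a < r -> inv_exp p a + coinv_exp p a = stair p a.
Proof.
move=> lta; rewrite /coinv_exp lta; have [c pc] := ex_place p ler.
have := inv_exp_stair a pc; lia.
Qed.

(** At the letters below a the exponents of p and q agree, so that the values
    r - t b there are the stairs 1, 2, ..., stair q a - 1.  As r - t a differs
    from these, it is at least stair q a, which says that the exponent of p at a
    is at least that of q. *)
Lemma inv_tri p q t :
  facet r p =1 facet r t -> facet r q =1 facet r t ->
  (forall a, inv_exp p a + coinv_exp q a = r - t a) ->
  (inv_key p <= inv_key q)%O.
Proof.
move=> fp fq Hx; apply: lexi_mkseq => i ltin eqpq.
set a := inord i : 'I_n.+1.
have {}eqpq b : b < a -> inv_exp p b = inv_exp q b.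
  rewrite /a inordK // => /eqpq; rewrite inord_val.
  by have := inv_exp_le p b; have := inv_exp_le q b; lia.
suff : inv_exp q a <= inv_exp p a by lia.
rewrite leqNgt; apply/negP => lt_pq.
have lta : q a < r.
  have [//|gea] := ltnP (q a) r.
  by move: lt_pq; rewrite [X in _ < X]/inv_exp [q a < r]ltnNge gea.
have lt_t b : (t b < r) = (q b < r) by rewrite (facetE (fq b)).
suff: #|[set b : 'I_n.+1 | (q b < r) && (b <= a)]| <= (stair q a).-1.
  by rewrite stair_card // /stair ltnn.
apply: (@card_le_bound _ (fun b => (r - t b).-1)).
  move=> b c; rewrite !inE -!lt_t => /andP [ltb _] /andP [ltc _] E.
  by apply: (@perm_inj _ t); apply: val_inj => /=; lia.
move=> b; rewrite inE => /andP [ltb leba].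
have tb : r - t b < stair q a.
  rewrite -Hx; have := inv_coinv_exp ltb; have := inv_coinv_exp lta.
  case: (ltngtP b a) leba => // [ltba|/val_inj ->] _; last lia.
  by rewrite eqpq //; have := stair_lt ltb ltba; lia.
by have := lt_t b; rewrite ltb; lia.
Qed.

(** At the first place i where the words differ, let q have the larger letter b,
    which p then has further right.  Every letter counted at b by p is also
    counted by q, and q counts in addition the letter of p at place i. *)
Lemma inv_code_lt p q i : i < r -> facet r p =1 facet r q ->
  (forall j, j < i -> letter p j = letter q j) ->
  letter p i < letter q i ->
  inv_exp p (letter q i) < inv_exp q (letter q i).
Proof.
move=> ltir fpq eqpq; set b := letter q i; set x0 := letter p i => lt0b.
have qb : q b = i :> nat by apply: place_letter; lia.
have px0 : p x0 = i :> nat by apply: place_letter; lia.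
have pbr : p b < r by rewrite (facetE (fpq b)) qb.
have geq x : i <= p x -> x < b -> i < q x.
  move=> lex ltxb; rewrite ltn_neqAle; apply/andP; split.
    apply/eqP => E; move: ltxb.
    by rewrite /b (letter_place (esym E)) ltnn.
  rewrite leqNgt; apply/negP => ltqx; have := eqpq _ ltqx.
  rewrite letterK => /(congr1 p) /(congr1 val) /=.
  by rewrite place_letter; have := ltn_ord (q x); lia.
have ipb : i < p b.
  rewrite ltn_neqAle; apply/andP; split.
    apply/eqP => E; move: lt0b.
    by rewrite /x0 (letter_place (esym E)) ltnn.
  rewrite leqNgt; apply/negP => ltpb; have := eqpq _ ltpb.
  rewrite letterK => /(congr1 q) /(congr1 val) /=.
  by rewrite place_letter ?qb; have := ltn_ord (p b); lia.
rewrite /inv_exp pbr qb ltir; apply: proper_card; apply/properP; split.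
  apply/subsetP => x; rewrite !inE => /andP [/andP [ltpx lexr] ltxb].
  rewrite ltxb geq //=; last lia.
  by have := facetE (fpq x); move=> [[_ ?] _]; lia.
exists x0; rewrite !inE; last by rewrite px0; lia.
rewrite lt0b geq ?px0 //=.
by have := facetE (fpq x0); move=> [[_ ?] _]; lia.
Qed.

(** The inversion table determines the word. *)
Lemma inv_inj p q : facet r p =1 facet r q -> inv_exp p =1 inv_exp q ->
  forall i, i < r -> letter p i = letter q i.
Proof.
move=> fpq eqe; elim/ltn_ind => i IH ltir.
have eqpq j : j < i -> letter p j = letter q j.
  by move=> ltji; apply: IH => //; lia.
apply: val_inj; case: (ltngtP (letter p i) (letter q i)) => // lt.
  by have := inv_code_lt ltir fpq eqpq lt; rewrite eqe ltnn.
have eqqp j : j < i -> letter q j = letter p j by move/eqpq.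
by have := inv_code_lt ltir (fsym fpq) eqqp lt; rewrite eqe ltnn.
Qed.

Lemma artin_system : alphabet_system r inv_exp coinv_exp inv_key.
Proof.
split.
- move=> p c a pc lta ltca; rewrite /inv_exp lta card_gt0.
  by apply/set0Pn; exists c; rewrite inE pc lta leqnn.
- move=> p c a pc lta ltac; rewrite /coinv_exp lta.
  by have := inv_exp_stair a pc; rewrite ltac; lia.
- by move=> p a; rewrite /coinv_exp /inv_exp ltnNge => ->.
- move=> p; pose f a : 'I_n.+1 := if p a < r then inord (r - stair p a) else p a.
  have fE a : p a < r -> f a = r - stair p a :> nat.
    by move=> lta; rewrite /f lta inordK // ltnS; lia.
  have fE' a : r <= p a -> f a = p a by move=> gea; rewrite /f ltnNge gea.
  have flt a : p a < r -> f a < r.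
    by move=> lta; rewrite fE //; have := stair_le lta; rewrite /stair; lia.
  have f_inj : injective f.
    move=> a b E; case: (ltnP (p a) r) => [lta|gea].
      case: (ltnP (p b) r) => [ltb|geb]; last first.
        by have := flt a lta; rewrite E fE' //; lia.
      have := congr1 val E; rewrite /= !fE //.
      have := stair_le lta; have := stair_le ltb.
      case: (ltngtP a b) => [ltab|ltba|/val_inj //].
        by have := stair_lt lta ltab; lia.
      by have := stair_lt ltb ltba; lia.
    case: (ltnP (p b) r) => [ltb|geb].
      by have := flt b ltb; rewrite -E fE' //; lia.
    by move: E; rewrite !fE' // => /perm_inj.
  exists (perm f_inj) => a; rewrite ?/facet permE.
    case: (ltnP (p a) r) => [lta|gea]; last by rewrite fE' // gea.
    by have := flt a lta; lia.
  case: (ltnP (p a) r) => [lta|gea].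
    by rewrite inv_coinv_exp // fE //; have := stair_le lta; lia.
  by rewrite fE' // /coinv_exp /inv_exp ltnNge gea /=; lia.
- exact: inv_tri.
- move=> p q fpq eqk a lta; apply: val_inj => /=.
  have eqe : inv_exp p =1 inv_exp q.
    move=> b; have := congr1 (nth 0 ^~ b) eqk.
    rewrite !nth_mkseq // inord_val.
    by have := inv_exp_le p b; have := inv_exp_le q b; lia.
  have := inv_inj fpq eqe lta; rewrite letterK => {2}->.
  by rewrite place_letter // -ltnS.
- by move=> p q; rewrite !size_mkseq.
Qed.

End Artin.

(** * Square systems and finite sums *)

Section LinearAlgebra.
Local Open Scope ring_scope.

Lemma square_system (K : fieldType) (I : finType) (E : I -> I -> K) :
  (forall c : I -> K, (forall s, \sum_i c i * E i s = 0) -> forall i, c i = 0) ->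
  forall v : I -> K, exists c : I -> K, forall s, v s = \sum_i c i * E i s.
Proof.
move=> inj v; pose A := \matrix_(i < #|I|, j < #|I|) E (enum_val i) (enum_val j).
have prodE (u : 'rV[K]_#|I|) s :
    (u *m A) 0 (enum_rank s) = \sum_i u 0 (enum_rank i) * E i s.
  rewrite mxE (reindex _ (onW_bij _ (@enum_rank_bij I))) /=.
  by apply: eq_bigr => i _; rewrite mxE !enum_rankK.
have freeA : row_free A.
  apply/inj_row_free => u uA0; apply/rowP => j.
  rewrite mxE -(enum_valK j); apply: (inj (fun i => u 0 (enum_rank i))) => s.
  by rewrite -prodE uA0 mxE.
have unitA : A \in unitmx by rewrite -row_free_unit.
pose u := \row_j v (enum_val j) *m invmx A.
exists (fun i => u 0 (enum_rank i)) => s.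
by rewrite -prodE mulmxKV // mxE enum_rankK.
Qed.

(** A polynomial of degree less than M that vanishes at 0, 1, ..., M-1 is zero. *)
Lemma exponential_sums_eq0 (I : finType) (P : pred I) (g : I -> nat) M
    (v : I -> rat) :
  {in P &, injective g} -> (forall i, P i -> (g i < M)%N) ->
  (forall j, (j < M)%N -> \sum_(i | P i) v i * j%:R ^+ g i = 0) ->
  forall i, P i -> v i = 0.
Proof.
move=> injg ltg H i Pi; pose p : {poly rat} := \sum_(i | P i) v i *: 'X^(g i).
have sizep : (size p <= M)%N.
  apply: leq_trans (size_sum _ _ _) _; apply/bigmax_leqP => j Pj.
  by apply: leq_trans (size_scale_leq _ _) _; rewrite size_polyXn ltg.
have p0 : p = 0.
  apply: (@roots_geq_poly_eq0 _ p [seq j%:R | j <- iota 0 M]).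
  - apply/allP => _ /mapP [j + ->]; rewrite mem_iota => ltj.
    rewrite rootE horner_sum; apply/eqP; rewrite -[RHS](H j ltj).
    by apply: eq_bigr => l _; rewrite hornerZ hornerXn.
  - rewrite map_inj_uniq ?iota_uniq // => a b /eqP.
    by rewrite eqr_nat => /eqP.
  - by rewrite size_map size_iota.
have := congr1 (fun q : {poly rat} => q`_(g i)) p0.
rewrite coef0 coef_sum (bigD1 i) //= coefZ coefXn eqxx mulr1.
rewrite big1 ?addr0 // => l /andP [Pl nel]; rewrite coefZ coefXn.
case: eqP => [/esym eqg|]; last by rewrite mulr0.
by move: nel; rewrite (injg _ _ Pl Pi eqg) eqxx.
Qed.

Lemma sum_option (V : nmodType) (I : finType) (P : pred (option I))
    (F : option I -> V) :
  \sum_(i | P i) F i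
  = (if P None then F None else 0) + \sum_(i | P (Some i)) F (Some i).
Proof.
rewrite big_mkcond (bigD1 None) //=; congr (_ + _).
rewrite (reindex_omap Some id) => [|[]] //=; rewrite [RHS]big_mkcond /=.
by apply: eq_bigl => i; rewrite eqxx.
Qed.

End LinearAlgebra.

(** * The ideal of the hook and the orbit of points *)

Section Hook.
Variables (n r : nat) (ler : (r <= n)%N).
Implicit Types (s t p q : 'S_n.+1) (a b c : 'I_n.+1).
Notation N := (n.+1 + n.+1)%N.
Implicit Types (m : 'X_{1..N}).
Local Open Scope ring_scope.

Definition xymono (ex ey : 'I_n.+1 -> nat) : 'X_{1..N} :=
  [multinom match split i with inl a => ex a | inr a => ey a end | i < N].

Lemma xymonoEx ex ey a : xymono ex ey (lshift _ a) = ex a.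
Proof. by rewrite mnmE (unsplitK (inl _ a)). Qed.

Lemma xymonoEy ex ey a : xymono ex ey (rshift _ a) = ey a.
Proof. by rewrite mnmE (unsplitK (inr _ a)). Qed.

Lemma xymonoP m1 m2 : (forall a, m1 (lshift _ a) = m2 (lshift _ a)) ->
  (forall a, m1 (rshift _ a) = m2 (rshift _ a)) -> m1 = m2.
Proof.
move=> Hx Hy; apply/mnmP => i; case: (splitP i) => j eqj.
  by rewrite (_ : i = lshift _ j) //; apply: val_inj.
by rewrite (_ : i = rshift _ j) //; apply: val_inj.
Qed.

Lemma xymonoX ex ey :
  'X_[xymono ex ey] = (\prod_a xvar a ^+ ex a) * (\prod_a yvar a ^+ ey a)
  :> {mpoly rat[N]}.
Proof.
rewrite mpolyXE_id big_split_ord /=; congr (_ * _); apply: eq_bigr => a _.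
  by rewrite xymonoEx.
by rewrite xymonoEy.
Qed.

(** The terms of the determinant: the letter at place i < r carries x to the
    power r - i, and the letter at place i > r carries y to the power i - r. *)
Definition hook_mono t : 'X_{1..N} :=
  xymono (fun a => (r - t a)%N) (fun a => (t a - r)%N).

Lemma hook_mono_inj : injective hook_mono.
Proof.
move=> s t E; apply/permP => a; apply: val_inj => /=.
have := congr1 (fun m => m (lshift _ a)) E; rewrite !xymonoEx.
have := congr1 (fun m => m (rshift _ a)) E; rewrite !xymonoEy; lia.
Qed.

(** Places from left to right correspond to the columns of the determinant in
    the order of decreasing powers of x, the constant, and increasing powers of
    y. *)
Lemma column_inj :
  injective (fun i : 'I_n.+1 => if (i < r)%N then rev_ord i else inord (i - r)).
Proof.
have Hi (i : 'I_n.+1) : (inord (i - r) : 'I_n.+1) = (i - r)%N :> nat.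
  by rewrite inordK //; have := ltn_ord i; lia.
move=> i j /(congr1 val) E; apply: val_inj; move: E => /=.
have := ltn_ord i; have := ltn_ord j.
by case: (ltnP i r); case: (ltnP j r); rewrite /= ?Hi; lia.
Qed.

Definition column : 'S_n.+1 := perm column_inj.

Notation Delta := (hook_Delta n.+1 r.+1).

Lemma hook_Delta_sum : Delta =
  (-1) ^+ column *: \sum_(t : 'S_n.+1) (-1) ^+ t *: 'X_[hook_mono t].
Proof.
rewrite /hook_Delta /determinant.
rewrite (reindex_inj (mulIg column)) /= scaler_sumr; apply: eq_bigr => t _.
rewrite scalerA -signr_addb odd_permM addbC mulr_sign scaler_sign.
set X := 'X_[_]; set Y := \prod_i _; suff -> : Y = X by [].
rewrite /X /Y xymonoX -big_split; apply: eq_bigr => a _ /=.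
rewrite mxE permM permE subSS; have := ltn_ord (t a).
case: (ltnP (t a) r) => ltr ltn /=.
  rewrite leqNgt ifN ?negbK; last lia.
  by rewrite (_ : (t a - r = 0)%N) ?expr0 ?mulr1; [congr (_ ^+ _)|]; lia.
rewrite inordK ?ifT; try lia.
by rewrite (_ : (r - t a = 0)%N) ?expr0 ?mul1r //; lia.
Qed.

Lemma Delta_mono t : Delta@_(hook_mono t) = (-1) ^+ column * (-1) ^+ t.
Proof.
rewrite hook_Delta_sum mcoeffZ raddf_sum (bigD1 t) //= big1.
  by rewrite addr0 mcoeffZ mcoeffX eqxx mulr1.
move=> s ne; rewrite mcoeffZ mcoeffX (inj_eq hook_mono_inj).
by rewrite (negbTE ne) mulr0.
Qed.

Lemma Delta_mono_neq0 t : Delta@_(hook_mono t) != 0.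
Proof. by rewrite Delta_mono mulf_neq0 // signr_eq0. Qed.

Lemma Delta_support m : Delta@_m != 0 -> exists t, m = hook_mono t.
Proof.
move=> nz; suff /existsP [t /eqP <-]: [exists t, hook_mono t == m] by exists t.
apply: contraNT nz; rewrite negb_exists => /forallP ne.
rewrite hook_Delta_sum mcoeffZ raddf_sum big1 ?mulr0 // => t _.
by rewrite /= mcoeffZ mcoeffX (negbTE (ne t)) mulr0.
Qed.

(** The product of the factorials of the exponents, the same for every term of
    the determinant. *)
Definition hook_fact : nat := \prod_(i < n.+1) ((r - i)`! * (i - r)`!)%N.

Lemma hook_fact_neq0 : hook_fact%:R != 0 :> rat.
Proof.
rewrite pnatr_eq0 -lt0n prodn_cond_gt0 // => i _.
by rewrite muln_gt0 !fact_gt0.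
Qed.

Lemma pairing_deriv m m' :
  pairing 'X_[m] Delta^`M[m'] = hook_fact%:R * Delta@_(m' + m).
Proof.
rewrite /pairing /diffop msuppX big_seq1 mcoeffX eqxx scale1r -mderivmDm.
rewrite mcoeff_mderivm addm0.
have [->|/Delta_support [t ->]] := eqVneq (Delta@_(m' + m)) 0.
  by rewrite mul0rn mulr0.
rewrite mulr_natl; congr (_ *+ _); rewrite big_split_ord /= -big_split /=.
rewrite /hook_fact [RHS](reindex_inj (@perm_inj _ t)); apply: eq_bigr => a _.
by rewrite xymonoEx xymonoEy !ffactnn.
Qed.

Lemma pairing_sum (I : Type) (s : seq I) (P : pred I) (c : I -> rat)
    (f : I -> {mpoly rat[N]}) g :
  pairing (\sum_(i <- s | P i) c i *: f i) g
  = \sum_(i <- s | P i) c i * pairing (f i) g.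
Proof.
have pair0 : pairing 0 g = 0 :> rat.
  by rewrite /pairing /diffop msupp0 big_nil mcoeff0.
elim: s => [|i s IH]; first by rewrite !big_nil pair0.
by rewrite !big_cons; case: ifP => // _; rewrite pairing_linearl IH.
Qed.

Lemma pairingr_sum (I : Type) (s : seq I) (c : I -> rat) f
    (g : I -> {mpoly rat[N]}) :
  pairing f (\sum_(i <- s) c i *: g i) = \sum_(i <- s) c i * pairing f (g i).
Proof.
have E h : pairing f h = \sum_(m <- msupp f) f@_m * (h^`M[m])@_0.
  by rewrite /pairing /diffop raddf_sum; apply: eq_bigr => m _ /=; rewrite mcoeffZ.
rewrite E; under eq_bigr do rewrite raddf_sum raddf_sum /= big_distrr /=.
rewrite exchange_big /=; apply: eq_bigr => i _.
rewrite E big_distrr /=; apply: eq_bigr => m _.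
by rewrite mderivmZ mcoeffZ mulrCA.
Qed.

(** As all terms of the determinant have the same product of factorials, the
    differential pairing may be replaced by the pairing that makes monomials
    orthonormal. *)
Lemma hook_J_sum (I : Type) (s : seq I) (P : pred I) (c : I -> rat)
    (mu : I -> 'X_{1..N}) :
  (\sum_(i <- s | P i) c i *: 'X_[mu i] \in @hook_J n.+1 r.+1) <->
  (forall m, \sum_(i <- s | P i) c i * Delta@_(m + mu i) = 0).
Proof.
have E m : pairing (\sum_(i <- s | P i) c i *: 'X_[mu i]) Delta^`M[m]
    = hook_fact%:R * \sum_(i <- s | P i) c i * Delta@_(m + mu i).
  rewrite pairing_sum big_distrr; apply: eq_bigr => i _ /=.
  by rewrite pairing_deriv mulrCA.
split=> [/boolp.asboolP J m|H].
  apply/eqP; rewrite -(mulrI_eq0 _ (mulfI hook_fact_neq0)) -E J //.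
  by exists [:: m], (fun=> 1); rewrite big_seq1 scale1r.
apply/boolp.asboolP => g [ms [w ->]]; rewrite pairingr_sum big1 // => m _.
by rewrite E H !mulr0.
Qed.

Lemma hook_proj_eq0 f : hook_proj r.+1 f = 0 <-> f \in @hook_J n.+1 r.+1.
Proof.
rewrite -{1}(linear0 (@hook_proj n.+1 r.+1)) (rwP eqP).
by rewrite hook_proj_eq subr0.
Qed.

Lemma hook_proj_sum (I : Type) (s : seq I) (P : pred I) (c : I -> rat)
    (f : I -> {mpoly rat[N]}) :
  hook_proj r.+1 (\sum_(i <- s | P i) c i *: f i)
  = \sum_(i <- s | P i) c i *: hook_proj r.+1 (f i).
Proof. by rewrite linear_sum; apply: eq_bigr => i _; rewrite linearZ. Qed.

Definition independent_mod (I : finType) (mu : I -> 'X_{1..N}) : Prop :=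
  forall c : I -> rat,
    \sum_i c i *: 'X_[mu i] \in @hook_J n.+1 r.+1 -> forall i, c i = 0.

(** Test a relation against the dual of the index of least key among those with
    a nonzero coefficient: a single term survives. *)
Lemma independent_of_triangular (I : finType) (mu nu : I -> 'X_{1..N})
    (key : I -> seqlexi nat) : injective key ->
  (forall i, Delta@_(nu i + mu i) != 0) ->
  (forall i j, Delta@_(nu j + mu i) != 0 -> (key i <= key j)%O) ->
  independent_mod mu.
Proof.
move=> key_inj diag tri c /hook_J_sum J i; apply/eqP; apply/negPn/negP => ci.
have [j cj minj] := arg_minP key (P := fun i => c i != 0) ci.
have := J (nu j); rewrite (bigD1 j) //= big1 => [|l nelj].
  by move/eqP; rewrite addr0 mulf_eq0 (negbTE cj) (negbTE (diag j)).
apply/eqP; rewrite mulf_eq0; apply/norP => -[cl /tri le_lj].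
by move: nelj; rewrite (key_inj l j) ?eqxx //; apply/le_anti; rewrite le_lj minj.
Qed.

(** The value of the monomial at the point whose coordinates are the exponents
    of the term of s.  These points form the S_n-orbit of the point that attaches
    distinct places on the two coordinate axes to the n letters. *)
Definition eval_at s m : rat := \prod_i (hook_mono s i)%:R ^+ m i.

Lemma eval_atD s m1 m2 : eval_at s (m1 + m2) = eval_at s m1 * eval_at s m2.
Proof.
by rewrite -big_split; apply: eq_bigr => i _; rewrite mnmDE exprD.
Qed.

(** The alternating sum over the orbit.  It deforms the pairing with the
    determinant: both agree up to a constant in degrees up to that of the
    determinant. *)
Definition alt_eval m : rat := \sum_(s : 'S_n.+1) (-1) ^+ s * eval_at s m.

Definition eval_mx m : 'M[rat]_n.+1 :=
  \matrix_(a, j) ((r - j)%:R ^+ m (lshift _ a) * (j - r)%:R ^+ m (rshift _ a)).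

Lemma eval_atE s m : eval_at s m = \prod_a eval_mx m a (s a).
Proof.
rewrite /eval_at big_split_ord /= -big_split; apply: eq_bigr => a _ /=.
by rewrite xymonoEx xymonoEy mxE.
Qed.

Lemma alt_evalE m : alt_eval m = \det (eval_mx m).
Proof. by apply: eq_bigr => s _; rewrite eval_atE. Qed.

Definition hook_deg : nat := ('C(r.+1, 2) + 'C((n - r).+1, 2))%N.

Lemma sum_sub k i : (i <= k)%N -> (\sum_(j < k) (i - j) = 'C(i.+1, 2))%N.
Proof.
elim: k i => [|k IH] [|i] // leik; first by rewrite big_ord0.
  by rewrite big1.
by rewrite big_ord_recl (IH i leik) subn0 [RHS]binS bin1 addnC.
Qed.

Lemma mdeg_hook_mono t : mdeg (hook_mono t) = hook_deg.
Proof.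
rewrite mdegE big_split_ord /=; congr (_ + _)%N.
  rewrite -(@sum_sub n.+1 r) ?leqW // [RHS](reindex_inj (@perm_inj _ t)).
  by apply: eq_bigr => a _; rewrite xymonoEx.
rewrite -(@sum_sub n.+1 (n - r)%N) ?leqW ?leq_subr // [RHS](reindex_inj rev_ord_inj).
rewrite [RHS](reindex_inj (@perm_inj _ t)); apply: eq_bigr => a _.
by rewrite xymonoEy /=; have := ltn_ord (t a); lia.
Qed.

(** A nonzero determinant has pairwise distinct rows and a nonzero term s.  The
    term gives at most r letters with an x, at most n - r with a y, none with
    both; distinctness leaves only one letter with neither, and makes the
    exponents of x, and those of y, distinct.  The degree is then least when these
    exponents are 0, ..., r and 0, ..., n - r. *)
Lemma alt_eval_support m : alt_eval m != 0 ->
  (hook_deg <= mdeg m)%N /\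
  ((mdeg m <= hook_deg)%N -> exists t, m = hook_mono t).
Proof.
rewrite alt_evalE => nz.
have [s nzs] : exists s, forall a, eval_mx m a ((s : 'S_n.+1) a) != 0.
  suff /existsP [s /forallP ?]: [exists s : 'S_n.+1,
      forall a, eval_mx m a (s a) != 0] by exists s.
  apply: contraNT nz; rewrite negb_exists => /forallP allz.
  rewrite /determinant big1 // => s _; have := allz s.
  rewrite negb_forall => /existsP [a]; rewrite negbK => /eqP z.
  by rewrite (bigD1 a) //= z mul0r mulr0.
pose mx a := m (lshift _ a); pose my a := m (rshift _ a).
have row_inj a b : mx a = mx b -> my a = my b -> a = b.
  move=> ex ey; apply/eqP/(contraNT _ nz) => ne; apply/eqP.
  apply: (determinant_alternate ne) => j; rewrite !mxE.
  by congr (_ ^+ _ * _ ^+ _).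
have ltx a : (0 < mx a -> s a < r)%N.
  move=> mx0; have := nzs a; rewrite mxE mulf_eq0 negb_or expf_eq0 mx0 /=.
  by rewrite pnatr_eq0 subn_eq0 -ltnNge => /andP [].
have gty a : (0 < my a -> r < s a)%N.
  move=> my0; have := nzs a; rewrite mxE mulf_eq0 negb_or !expf_eq0 my0 /=.
  by rewrite !pnatr_eq0 !subn_eq0 -!ltnNge => /andP [].
pose Sx := [set a | (s a < r.+1)%N].
pose Sy := [set a | (position_rev s a < (n - r).+1)%N].
have inSy a : (a \in Sy) = (r <= s a)%N.
  by rewrite inE permE /=; have := ltn_ord (s a); lia.
have inSx a : (a \in Sx) = (s a <= r)%N by rewrite inE.
have cSx : #|Sx| = r.+1 by apply: card_place_lt.
have cSy : #|Sy| = (n - r).+1 by apply: card_place_lt; rewrite ltnS leq_subr.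
have injx : {in Sx &, injective mx}.
  move=> a b; rewrite !inSx => lea leb eqx; apply: row_inj => //.
  by have := gty a; have := gty b; lia.
have injy : {in Sy &, injective my}.
  move=> a b; rewrite !inSy => lea leb eqy; apply: row_inj => //.
  by have := ltx a; have := ltx b; lia.
have degm : mdeg m = (\sum_(a in Sx) mx a + \sum_(a in Sy) my a)%N.
  rewrite mdegE big_split_ord /=; congr (_ + _)%N.
    rewrite (bigID (mem Sx)) /= [X in (_ + X)%N]big1 ?addn0 // => a.
    by rewrite inSx; have := ltx a; rewrite /mx; lia.
  rewrite (bigID (mem Sy)) /= [X in (_ + X)%N]big1 ?addn0 // => a.
  by rewrite inSy; have := gty a; rewrite /my; lia.
have gex := sum_distinct_ge injx; have gey := sum_distinct_ge injy.
rewrite degm /hook_deg; rewrite cSx in gex; rewrite cSy in gey.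
split=> [|ledeg]; first exact: leq_add.
have := sum_distinct_eq injx; rewrite cSx => /(_ ltac:(lia)) lemx.
have := sum_distinct_eq injy; rewrite cSy => /(_ ltac:(lia)) lemy.
have {}lemx a : (s a <= r -> mx a <= r)%N by rewrite -inSx => /lemx.
have {}lemy a : (r <= s a -> my a <= n - r)%N by rewrite -inSy => /lemy.
pose f a : 'I_n.+1 := inord (if (s a <= r)%N then (r - mx a)%N else (r + my a)%N).
have fE a : f a = (if (s a <= r)%N then (r - mx a)%N else (r + my a)%N) :> nat.
  rewrite inordK //; case: (leqP (s a) r) => H.
    by have := lemx a; lia.
  by have := lemy a; lia.
have f_inj : injective f.
  move=> a b /(congr1 val); rewrite /= !fE => E.
  have := lemx a; have := lemx b; have := ltx a; have := ltx b.
  have := gty a; have := gty b; move=> ? ? ? ? ? ?.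
  apply: row_inj; move: E;
    case: (leqP (s a) r); case: (leqP (s b) r); lia.
exists (perm f_inj); apply: xymonoP => a.
  rewrite xymonoEx permE fE -/(mx a).
  by have := ltx a; have := lemx a; case: (leqP (s a) r); lia.
rewrite xymonoEy permE fE -/(my a).
by have := gty a; case: (leqP (s a) r); lia.
Qed.

Lemma alt_eval_mono t :
  alt_eval (hook_mono t) = (-1) ^+ t * alt_eval (hook_mono 1).
Proof.
rewrite !alt_evalE -det_perm -det_mulmx -row_permE; congr (\det _).
by apply/matrixP => a j; rewrite !mxE !xymonoEx !xymonoEy perm1.
Qed.

(** Left kernel vectors of the matrix are polynomials on the cross formed by
    the two axes; on each axis they vanish at more points than their degree. *)
Lemma alt_eval_neq0 : alt_eval (hook_mono 1) != 0.
Proof.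
rewrite alt_evalE; apply/det0P => -[v /eqP nzv vN0]; apply: nzv.
have vN j : (j <= n)%N ->
    \sum_i v 0 i * ((r - j)%:R ^+ (r - i) * (j - r)%:R ^+ (i - r)) = 0.
  move=> lej; have := congr1 (fun w : 'rV_n.+1 => w 0 (inord j)) vN0.
  rewrite !mxE => vj; rewrite -[RHS]vj; apply: eq_bigr => l _.
  by rewrite mxE xymonoEx xymonoEy perm1 inordK.
apply/rowP => i; rewrite mxE; case: (leqP r i) => [leri|/ltnW leir].
  apply: (@exponential_sums_eq0 'I_n.+1 (fun i => r <= i)%N
    (fun i => i - r)%N (n - r).+1 (v 0) _ _ _ i leri) => [a b|a|j ltj].
  - by rewrite !unfold_in => ? ? ?; apply: val_inj => /=; lia.
  - by have := ltn_ord a; lia.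
  rewrite -[RHS](vN (j + r)%N); last lia.
  rewrite [RHS](bigID (fun i : 'I__ => r <= i)%N) /=.
  rewrite [X in _ = _ + X]big1 ?addr0 => [|l]; last first.
    move=> ltl; have E : ((r - l)%N == 0%N) = false by lia.
    by rewrite (_ : (r - (j + r) = 0)%N) ?expr0n ?E ?mul0r ?mulr0 //; lia.
  apply: eq_bigr => l lel; rewrite addnK.
  by rewrite (_ : (r - l = 0)%N) ?expr0 ?mul1r //; lia.
apply: (@exponential_sums_eq0 'I_n.+1 (fun i => i <= r)%N
  (fun i => r - i)%N r.+1 (v 0) _ _ _ i leir) => [a b|a _|j ltj].
- by rewrite !unfold_in => ? ? ?; apply: val_inj => /=; lia.
- by rewrite ltnS leq_subr.
rewrite -[RHS](vN (r - j)%N); last lia.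
rewrite [RHS](bigID (fun i : 'I__ => i <= r)%N) /=.
rewrite [X in _ = _ + X]big1 ?addr0 => [|l]; last first.
  move=> ltl; have E : ((l - r)%N == 0%N) = false by lia.
  by rewrite (_ : (r - j - r = 0)%N) ?expr0n ?E ?mulr0 //; lia.
apply: eq_bigr => l lel; rewrite subKn //.
by rewrite (_ : (l - r = 0)%N) ?expr0 ?mulr1 //; lia.
Qed.

Lemma Delta_alt_eval : exists w : rat,
  forall m, (mdeg m <= hook_deg)%N -> Delta@_m = w * alt_eval m.
Proof.
exists ((-1) ^+ column / alt_eval (hook_mono 1)) => m lem.
have [z|/alt_eval_support [_ /(_ lem) [t ->]]] :=
    eqVneq (alt_eval m) 0; last first.
  rewrite Delta_mono (alt_eval_mono t) mulrACA mulVf ?alt_eval_neq0 //.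
  by rewrite mulr1.
rewrite z mulr0; have [//|/Delta_support [t eqm]] := eqVneq (Delta@_m) 0.
move/eqP: z; rewrite eqm (alt_eval_mono t) mulf_eq0 signr_eq0.
by rewrite (negbTE alt_eval_neq0).
Qed.

Lemma Delta_degree m : Delta@_m != 0 -> mdeg m = hook_deg.
Proof. by case/Delta_support => t ->; apply: mdeg_hook_mono. Qed.

(** If a polynomial of degree at most d vanishes on the orbit, so does its
    product with any monomial, and the alternating sum over the orbit is 0.  In
    degree hook_deg this sum is proportional to the pairing with the determinant,
    which sees nothing but the part of degree d. *)
Lemma top_form_in_J (I : finType) (c : I -> rat) (mu : I -> 'X_{1..N}) d :
  (forall i, c i != 0 -> (mdeg (mu i) <= d)%N) ->
  (forall s, \sum_i c i * eval_at s (mu i) = 0) ->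
  \sum_(i | mdeg (mu i) == d) c i *: 'X_[mu i] \in @hook_J n.+1 r.+1.
Proof.
move=> led vanish; apply/hook_J_sum => m.
have [ltd|led'] := ltnP hook_deg (mdeg m + d)%N.
  rewrite big1 // => i /eqP eqd; apply/eqP; rewrite mulf_eq0; apply/orP; right.
  by apply: contraLR ltd => /Delta_degree; rewrite mdegD eqd -leqNgt => ->.
transitivity (\sum_i c i * Delta@_(m + mu i)).
  rewrite [RHS](bigID (fun i => mdeg (mu i) == d)) /= [X in _ + X]big1 ?addr0 //.
  move=> i ned; apply/eqP; rewrite mulf_eq0; apply/norP => -[/led lei].
  by move/Delta_degree; rewrite mdegD => eqd; case/eqP: ned; lia.
have [w Hw] := Delta_alt_eval.
transitivity (\sum_i w * (c i * alt_eval (m + mu i))).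
  apply: eq_bigr => i _; have [->|/led lei] := eqVneq (c i) 0.
    by rewrite !mul0r mulr0.
  rewrite Hw; first exact: mulrCA.
  by rewrite mdegD; lia.
rewrite -big_distrr /= /alt_eval; under eq_bigr do rewrite big_distrr /=.
rewrite exchange_big /= big1 ?mulr0 // => s _.
transitivity ((-1) ^+ s * eval_at s m * \sum_i c i * eval_at s (mu i)).
  rewrite big_distrr; apply: eq_bigr => i _ /=; rewrite eval_atD.
  by rewrite mulrCA -mulrA; congr (_ * _); apply: mulrCA.
by rewrite vanish mulr0.
Qed.

(** The top-degree part of a relation on the orbit would be a relation modulo
    the ideal. *)
Lemma eval_at_independent (I : finType) (mu : I -> 'X_{1..N}) (c : I -> rat) :
  independent_mod mu -> (forall s, \sum_i c i * eval_at s (mu i) = 0) ->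
  forall i, c i = 0.
Proof.
move=> indep vanish i0; apply/eqP/negPn/negP => ci0.
have [i ci maxi] := @arg_maxnP _ i0 (fun i => c i != 0) (fun i => mdeg (mu i)) ci0.
have := top_form_in_J (c := c) (d := mdeg (mu i)) maxi vanish.
rewrite big_mkcond /= (eq_bigr (fun j => (if mdeg (mu j) == mdeg (mu i)
  then c j else 0) *: 'X_[mu j])) => [/indep /(_ i)|j _]; last first.
  by case: ifP; rewrite ?scale0r.
by rewrite eqxx => /eqP; rewrite (negbTE ci).
Qed.

(** The orbit has as many points as there are monomials in the family, so on it
    any monomial X^m is a combination of the family.  The members of degree
    greater than that of X^m do not occur, for their top part would be a relation
    modulo the ideal.  The part of degree mdeg m then expresses X^m modulo
    the ideal. *)
Lemma basis_of_independent (mu : 'S_n.+1 -> 'X_{1..N}) :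
  independent_mod mu -> forms_basis r.+1 (fun p => 'X_[mu p]).
Proof.
move=> indep; split=> [c c0|].
  by apply: indep; apply/hook_proj_eq0; rewrite hook_proj_sum.
pose spanned (v : hook_quot n.+1 r.+1) := exists c : 'S_n.+1 -> rat,
  v = \sum_p c p *: hook_proj r.+1 'X_[mu p].
have spanX m : spanned (hook_proj r.+1 'X_[m]).
  have [c Hc] := square_system (E := fun p s => eval_at s (mu p))
    (fun w : 'S_n.+1 -> rat => @eval_at_independent _ mu w indep)
    (fun s => eval_at s m).
  (* The relation on the orbit between the family and X^m, indexed by None. *)
  pose mu' (i : option 'S_n.+1) := if i is Some p then mu p else m.
  pose c' (i : option 'S_n.+1) := if i is Some p then - c p else 1.
  have vanish s : \sum_i c' i * eval_at s (mu' i) = 0.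
    rewrite sum_option /= mul1r Hc -big_split big1 // => p _ /=.
    by rewrite mulNr subrr.
  have led p : c p != 0 -> (mdeg (mu p) <= mdeg m)%N.
    move=> cp; rewrite leqNgt; apply/negP => ltp.
    have [q /andP [cq ltq] maxq] := @arg_maxnP _ p
      (fun p => (c p != 0) && (mdeg m < mdeg (mu p))%N) (fun p => mdeg (mu p))
      (introT andP (conj cp ltp)).
    have le_q i : c' i != 0 -> (mdeg (mu' i) <= mdeg (mu q))%N.
      case: i => [p'|] /=; last by rewrite ltnW.
      rewrite oppr_eq0 => cp'; have [lt'|] := ltnP (mdeg m) (mdeg (mu p')).
        by apply: maxq; rewrite cp'.
      by move=> le'; apply: leq_trans le' (ltnW ltq).
    have := top_form_in_J le_q vanish; rewrite sum_option /= ltn_eqF // add0r.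
    rewrite big_mkcond /= (eq_bigr (fun j => (if mdeg (mu j) == mdeg (mu q)
      then - c j else 0) *: 'X_[mu j])) => [/indep /(_ q)|j _]; last first.
      by case: ifP; rewrite ?scale0r.
    by rewrite eqxx => /eqP; rewrite oppr_eq0 (negbTE cq).
  have le_m i : c' i != 0 -> (mdeg (mu' i) <= mdeg m)%N.
    by case: i => [p|] //=; rewrite oppr_eq0 => /led.
  have /hook_proj_eq0 := top_form_in_J le_m vanish.
  rewrite hook_proj_sum sum_option /= eqxx scale1r => /eqP.
  rewrite addr_eq0 => /eqP ->.
  exists (fun p => if mdeg (mu p) == mdeg m then c p else 0).
  rewrite big_mkcond -sumrN; apply: eq_bigr => p _ /=.
  by case: ifP => _; rewrite ?scale0r ?oppr0 // scaleNr opprK.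
have spanD u v (a : rat) : spanned u -> spanned v -> spanned (a *: u + v).
  move=> [c ->] [c' ->]; exists (fun p => a * c p + c' p).
  rewrite scaler_sumr -big_split; apply: eq_bigr => p _ /=.
  by rewrite scalerDl scalerA.
move=> v; change (spanned v); rewrite -(hook_reprK v) (mpolyE (hook_repr v)).
rewrite hook_proj_sum; elim: (msupp _) => [|m ms IH].
  rewrite big_nil; exists (fun=> 0); rewrite big1 // => p _; exact: scale0r.
by rewrite big_cons; apply: spanD.
Qed.

End Hook.

(** * The three families *)

Section Main.
Variables (n r : nat) (ler : r <= n).
Implicit Types (p q pi : 'S_n.+1) (a b i : 'I_n.+1).

Lemma letter_revcomp p l : l <= n ->
  letter (revcomp p) l = rev_ord (letter p (n - l)).
Proof.
by move=> lel; apply: letter_place; rewrite revcompE place_letter; lia.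
Qed.

Lemma des_revcomp p j : j < n -> des (revcomp p) (n - j.+1) = des p j.
Proof.
move=> ltj; rewrite /des !letter_revcomp; try lia.
rewrite subKn // (_ : n - (n - j.+1).+1 = j); last lia.
by rewrite /=; have := ltn_ord (letter p j); have := ltn_ord (letter p j.+1); lia.
Qed.

Lemma letterV pi l : letter pi^-1%g l = pi (inord l).
Proof. by rewrite /letter invgK. Qed.

(** The last index has no successor, hence the bound n instead of n + 1. *)
Lemma card_Des pi (P : pred nat) : ~~ P n ->
  #|[set j in Des pi | P (j : 'I_n.+1)]| = \sum_(j < n | P j) des pi^-1%g j.
Proof.
move=> Pn; rewrite -sum1dep_card big_mkcond big_ord_recr /= (negbTE Pn) andbF addn0.
rewrite [RHS]big_mkcond; apply: eq_bigr => j _ /=.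
rewrite andbC; case: (P j) => //=; rewrite inE /des !letterV.
have -> : inord j = widen_ord (leqnSn n) j :> 'I_n.+1.
  by apply: val_inj; rewrite /= inordK // ltnW // ltnS.
suff -> : [exists i : 'I_n.+1, (pos i == (pos (widen_ord (leqnSn n) j)).+1)
    && (pi i < pi (widen_ord (leqnSn n) j))]
    = (pi (inord j.+1) < pi (widen_ord (leqnSn n) j)) by case: ltnP.
have E : (inord j.+1 : 'I_n.+1) = j.+1 :> nat by rewrite inordK // ltnS.
apply/existsP/idP => [[i /andP [/eqP eqi]]|lt].
  by rewrite (_ : inord j.+1 = i) //; apply: val_inj; rewrite /= E; case: eqi.
by exists (inord j.+1); rewrite lt /pos /= E eqxx.
Qed.

Lemma dstat_x pi i : i < r -> dstat r.+1 pi i = des_exp r pi^-1%g (pi i).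
Proof.
move=> lti; rewrite /dstat /pos ltnS lti /des_exp permK.
rewrite (card_Des _ (P := fun j => i < j.+1 < r.+1)); last by lia.
by rewrite [RHS](big_ord_widen_cond n (fun j => i <= j)
  (fun j => des pi^-1%g j : nat) ler).
Qed.

Lemma dstat_y pi i : r < i ->
  dstat r.+1 pi i = des_exp (n - r) (revcomp pi^-1%g) (rev_ord (pi i)).
Proof.
move=> lti; rewrite /dstat /pos !ltnS lti ltnNge ltnW //= /des_exp.
rewrite revcompE permK (card_Des _ (P := fun j => r < j.+1 < i.+1)); last first.
  by have := ltn_ord i; lia.
rewrite [RHS](big_ord_widen_cond n (fun j => n - i <= j)
  (fun j => des (revcomp pi^-1%g) j : nat) (leq_subr r n)).
rewrite [RHS](reindex_inj rev_ord_inj) /=; apply: eq_big => j.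
  by have := ltn_ord j; have := ltn_ord i; lia.
by move=> _; rewrite des_revcomp.
Qed.

Lemma invstat_x pi i : i < r -> invstat r.+1 pi i = inv_exp r pi^-1%g (pi i).
Proof.
move=> lti; rewrite /invstat /pos ltnS lti /inv_exp permK lti.
rewrite -!sum1dep_card [RHS](reindex_inj (@perm_inj _ pi)) /=.
by apply: eq_bigl => j; rewrite permK.
Qed.

Lemma invstat_y pi i : r < i ->
  invstat r.+1 pi i = inv_exp (n - r) (revcomp pi^-1%g) (rev_ord (pi i)).
Proof.
move=> lti; rewrite /invstat /pos !ltnS lti ltnNge ltnW //= /inv_exp.
rewrite revcompE permK ifT; last by have := ltn_ord i; lia.
rewrite -!sum1dep_card [RHS](reindex_inj rev_ord_inj).
rewrite [RHS](reindex_inj (@perm_inj _ pi)) /=.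
apply: eq_bigl => j; rewrite revcompE permK.
have := ltn_ord i; have := ltn_ord j; have := ltn_ord (pi i).
by have := ltn_ord (pi j); lia.
Qed.

Section TwoSystems.
Variables (e d : 'S_n.+1 -> 'I_n.+1 -> nat) (key : 'S_n.+1 -> lexseq).
Variables (e' d' : 'S_n.+1 -> 'I_n.+1 -> nat) (key' : 'S_n.+1 -> lexseq).
Hypothesis sysx : alphabet_system r e d key.
Hypothesis sysy : alphabet_system (n - r) e' d' key'.

(** A permutation of the statement sends places to letters, hence the inverse. *)
Definition system_mono (f f' : 'S_n.+1 -> 'I_n.+1 -> nat) pi :=
  xymono (f pi^-1%g) (fun a => f' (revcomp pi^-1%g) (rev_ord a)).

Lemma system_independent : independent_mod r (system_mono e e').
Proof.
apply: (@independent_of_triangular _ _ ler _ _ (system_mono d d')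
  (fun pi => hook_key r key key' pi^-1%g)).
- by move=> p q /(hook_key_inj ler sysx sysy) /invg_inj.
- move=> p; have [t [Hx Hy]] := hook_key_diag ler sysx sysy p^-1%g.
  suff -> : (system_mono d d' p + system_mono e e' p)%MM = hook_mono r t.
    exact: Delta_mono_neq0.
  apply: xymonoP => a; rewrite mnmDE.
    by rewrite !xymonoEx addnC Hx.
  by rewrite !xymonoEy addnC Hy.
- move=> p q /Delta_support [//|t E].
  apply: (hook_key_tri ler sysx sysy (t := t)) => a.
    have := congr1 (fun m : 'X_{1.. _} => m (lshift _ a)) E.
    by rewrite mnmDE !xymonoEx addnC.
  have := congr1 (fun m : 'X_{1.. _} => m (rshift _ a)) E.
  by rewrite mnmDE !xymonoEy addnC.
Qed.

Lemma hook_monomialE pi ex ey :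
  (forall i, i < r -> ex i = e pi^-1%g (pi i)) ->
  (forall i, r < i -> ey i = e' (revcomp pi^-1%g) (rev_ord (pi i))) ->
  hook_monomial r.+1 pi ex ey = 'X_[system_mono e e' pi]%R.
Proof.
move=> Hx Hy; rewrite xymonoX; congr (_ * _)%R.
  rewrite [RHS](reindex_inj (@perm_inj _ pi)) [LHS]big_mkcond /=.
  apply: eq_bigr => i _; rewrite /pos ltnS; case: ltnP => [/Hx -> //|gei].
  have [-> _] := sys_out sysx (p := pi^-1%g) (a := pi i) ltac:(by rewrite permK).
  by rewrite expr0.
rewrite [RHS](reindex_inj (@perm_inj _ pi)) [LHS]big_mkcond /=.
apply: eq_bigr => i _; rewrite /pos ltnS; case: ltnP => [/Hy -> //|lei].
have [-> _] := sys_out sysy (p := revcomp pi^-1%g) (a := rev_ord (pi i))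
  ltac:(by rewrite revcompE permK leq_sub2l).
by rewrite expr0.
Qed.

Lemma system_basis (ex ey : 'S_n.+1 -> 'I_n.+1 -> nat) :
  (forall pi i, i < r -> ex pi i = e pi^-1%g (pi i)) ->
  (forall pi i, r < i -> ey pi i = e' (revcomp pi^-1%g) (rev_ord (pi i))) ->
  forms_basis r.+1 (fun pi => hook_monomial r.+1 pi (ex pi) (ey pi)).
Proof.
move=> Hx Hy; have := basis_of_independent ler system_independent.
congr (forms_basis _ _); apply: boolp.funext => pi.
by rewrite hook_monomialE; [|exact: Hx|exact: Hy].
Qed.

End TwoSystems.
End Main.

Theorem corollary1p7 (n k : nat) (hk1 : 1 <= k) (hkn : k <= n) :
  [/\ forms_basis k (@descent_monomial n k),
      forms_basis k (@artin_monomial n k)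
    & forms_basis k (@haglund_monomial n k)].
Proof.
case: k hk1 hkn => // r _; case: n => // n ler; rewrite ltnS in ler.
have ler' : n - r <= n := leq_subr r n.
have desx := descent_system ler; have desy := descent_system ler'.
have invx := artin_system ler; have invy := artin_system ler'.
split.
- by apply: (system_basis ler desx desy) => pi i;
    [apply: dstat_x|apply: dstat_y].
- by apply: (system_basis ler invx invy) => pi i;
    [apply: invstat_x|apply: invstat_y].
- by apply: (system_basis ler desx invy) => pi i;
    [apply: dstat_x|apply: invstat_y].
Qed.
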